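(* Assume that $C_0$ and $T^*T$ commute. If $\varphi$ is not an eigenvector of $C_0^{1/2}T^*TC_0^{1/2}$, then the MAP test $\Psi_{\mathrm{MAP}}$ has level $$\sup\left\{\mathbb P_{u^\dagger}\left[\Psi_{\mathrm{MAP}}(Y)=1\right]:u^\dagger\in\mathcal X_H\right\}=1.$$
   Context: $\mathcal X,\mathcal Y$ are real separable Hilbert spaces, $\varphi$ is a bounded linear functional on $\mathcal X$ (identified with an element of $\mathcal X$), $T:\mathcal X\to\mathcal Y$ is bounded linear with adjoint $T^*$, $\sigma>0$, $m_0\in\mathcal X$, and $C_0$ is a self-adjoint, positive definite, trace class operator on $\mathcal X$. $Z$ is Gaussian white noise on $\mathcal Y$: a family $(Z(g))_{g\in\mathcal Y}$ of centered, jointly Gaussian random variables, linear in $g$, with $\mathbb E[Z(g)Z(h)]=\langle g,h\rangle_{\mathcal Y}$. For $u\in\mathcal X$, $\mathbb P_u$ denotes the law of the data $Y=Tu+\sigma Z$, i.e. $Y(g)=\langle Tu,g\rangle_{\mathcal Y}+\sigma Z(g)$; realizations $y$ of $Y$ are linear functionals on $\mathcal Y$. For the Bayesian model with prior $\Pi=\mathcal N(m_0,C_0)$ (independent of $Z$), the posterior is almost surely the Gaussian measure $\Pi(\cdot|Y=y)=\mathcal N(m,C)$ on $\mathcal X$ with $C=\sigma^2C_0^{1/2}(C_0^{1/2}T^*TC_0^{1/2}+\sigma^2\mathrm{Id})^{-1}C_0^{1/2}$ and $m=m_0+C_0^{1/2}(C_0^{1/2}T^*TC_0^{1/2}+\sigma^2\mathrm{Id})^{-1}C_0^{1/2}T^*(y-Tm_0)$,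 where $C_0^{1/2}T^*y\in\mathcal X$ is the Riesz representer of $x\mapsto y(TC_0^{1/2}x)$. Put $\mathcal X_H=\{x\in\mathcal X:\langle\varphi,x\rangle\le0\}$, $\mathcal X_K=\{x\in\mathcal X:\langle\varphi,x\rangle>0\}$. The maximum a posteriori (MAP) test is $\Psi_{\mathrm{MAP}}(y)=1$ if $\Pi(\mathcal X_K|Y=y)>\Pi(\mathcal X_H|Y=y)$ and $\Psi_{\mathrm{MAP}}(y)=0$ otherwise.
   Formalization: The functional φ is assumed nonzero: for φ = 0, which is not an eigenvector by convention, the MAP test is constantly 0 and its level is 0. As the context presupposes, the Riesz representer of x ↦ Z(TC_0^{1/2}x) is assumed to exist almost surely. *)

(* Defs.v *)
From HB Require Import structures.
From mathcomp Require Import all_boot all_order all_algebra.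
From mathcomp Require Import all_classical all_reals all_analysis.

Set Implicit Arguments.
Unset Strict Implicit.
Unset Printing Implicit Defensive.

Import Order.TTheory GRing.Theory Num.Theory.
Import numFieldNormedType.Exports.

Local Open Scope classical_set_scope.
Local Open Scope ring_scope.

Structure hilbertSpace (R : realType) := HilbertSpace {
  hilbert_sort :> completeNormedModType R ;
  inner : hilbert_sort -> hilbert_sort -> R ;
  innerC : forall x y, inner x y = inner y x ;
  innerDl : forall x y z, inner (x + y) z = inner x z + inner y z ;
  innerZl : forall a x y, inner (a *: x) y = a * inner x y ;
  inner_norm : forall x, inner x x = `|x| ^+ 2 }.

Definition separable (V : topologicalType) : Prop :=
  exists D : set V, countable D /\ dense D.

Section operators.
Variables (R : realType) (X Y : hilbertSpace R).

(* [is_adjoint T T'] determines [T'] uniquely and forces it to be linear. *)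
Definition is_adjoint (T : X -> Y) (T' : Y -> X) : Prop :=
  forall x y, inner (T x) y = inner x (T' y).

Definition self_adjoint (A : X -> X) : Prop :=
  forall x y, inner (A x) y = inner x (A y).

Definition positive_semidefinite (A : X -> X) : Prop :=
  forall x, 0 <= inner (A x) x.

Definition positive_definite (A : X -> X) : Prop :=
  forall x, x != 0 -> 0 < inner (A x) x.

Definition is_inverse (A B : X -> X) : Prop := cancel A B /\ cancel B A.

Definition is_eigenvector (A : X -> X) (v : X) : Prop :=
  v != 0 /\ exists lambda : R, A v = lambda *: v.

Definition riesz_representer (l : X -> R) (r : X) : Prop :=
  forall x, l x = inner r x.

(* Complete orthonormal system. *)
Definition orthonormal_basis (E : set X) : Prop :=
  (forall e f, E e -> E f -> inner e f = (e == f)%:R) /\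
  (forall x, (forall e, E e -> inner x e = 0) -> x = 0).

(* Bounded positive square root; for a bounded self-adjoint positive operator
   there is exactly one. *)
Definition is_sqrt (A S : X -> X) : Prop :=
  [/\ linear S, continuous S, self_adjoint S, positive_semidefinite S &
      forall x, S (S x) = A x].

End operators.

(* [absC] is |C| = (C^* C)^{1/2}; trace class means that sum_e <|C| e, e> is
   finite, a property which does not depend on the orthonormal basis. *)
Definition trace_class (R : realType) (X : hilbertSpace R) (C : X -> X) :
    Prop :=
  exists (C' absC : X -> X) (E : set X),
    [/\ is_adjoint C C', is_sqrt (C' \o C) absC, orthonormal_basis E &
        (\esum_(e in E) (inner (absC e) e)%:E < +oo)%E].

(* N(m, v) with the convention N(m, 0) = Dirac mass at m; [normal_prob] takes
   the standard deviation and is not a Dirac mass when it vanishes. *)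
Definition normal_law (R : realType) (m v : R) (B : set R) : \bar R :=
  if v == 0 then \d_m B else normal_prob m (Num.sqrt v) B.

Definition has_normal_law d (Omega : measurableType d) (R : realType)
    (P : probability Omega R) (f : Omega -> R) (m v : R) : Prop :=
  forall B : set R, measurable B -> P (f @^-1` B) = normal_law m v B.

Notation borel V := (g_sigma_algebraType (@open V)).

Definition is_gaussian_measure (R : realType) (X : hilbertSpace R)
    (mu : probability (borel X) R) (m : X) (C : X -> X) : Prop :=
  forall x : X, has_normal_law mu (inner x : X -> R) (inner x m)
                               (inner (C x) x).

Section white_noise.
Variables (R : realType) (Y : hilbertSpace R).
Variables (d : measure_display) (Omega : measurableType d).
Variables (P : probability Omega R) (Z : Y -> {RV P >-> R}).

Definition jointly_gaussian : Prop :=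
  forall (n : nat) (g : 'I_n -> Y) (a : 'I_n -> R),
    exists m v : R, 0 <= v /\
      has_normal_law P (fun w => \sum_(i < n) a i * Z (g i) w) m v.

Definition white_noise : Prop :=
  [/\ forall (w : Omega) (a : R) (g h : Y),
        Z (a *: g + h) w = a * Z g w + Z h w,
      jointly_gaussian,
      forall g, ('E_P[Z g] = 0)%E &
      forall g h, ('E_P[(fun w => (Z g w * Z h w)%R)] = (inner g h)%:E)%E].

End white_noise.

Section inverse_problem.
Variables (R : realType) (X Y : hilbertSpace R) (T : X -> Y) (sigma : R).

Definition data (d : measure_display) (Omega : measurableType d)
    (P : probability Omega R) (Z : Y -> {RV P >-> R}) (u : X) (w : Omega) :
    Y -> R :=
  fun g => inner (T u) g + sigma * Z g w.

(* The law P_u of the data, for the completion of P: the outer measure [P^*]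
   agrees with P on measurable events and with the completion of P on events
   that differ from a measurable one by a P-null set.  The completion matters
   because the Riesz representer C_0^{1/2} T^* Y, hence the posterior, is only
   defined almost surely. *)
Definition data_law (d : measure_display) (Omega : measurableType d)
    (P : probability Omega R) (Z : Y -> {RV P >-> R}) (u : X)
    (B : set (Y -> R)) : \bar R :=
  (P^*)%mu (data Z u @^-1` B).

(* [S] stands for C_0^{1/2} and [K] for
   (C_0^{1/2} T^* T C_0^{1/2} + sigma^2 Id)^{-1}. *)
Definition posterior_cov (S K : X -> X) : X -> X :=
  fun x => sigma ^+ 2 *: S (K (S x)).

(* [m] is m_0 + C_0^{1/2} K C_0^{1/2} T^* (y - T m_0), where
   C_0^{1/2} T^* (y - T m_0) is the Riesz representer of
   x |-> (y - <T m_0, .>) (T C_0^{1/2} x). *)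
Definition is_posterior_mean (S K : X -> X) (m0 : X) (y : Y -> R) (m : X) :
    Prop :=
  exists r : X,
    riesz_representer
      (fun x => y (T (S x)) - inner (T m0) (T (S x))) r /\
    m = m0 + S (K r).

(* [Post y] is the posterior N(m, C) given the realization y, for every y for
   which the mean m is defined. *)
Definition is_posterior (S K : X -> X) (m0 : X)
    (Post : (Y -> R) -> probability (borel X) R) : Prop :=
  forall y m, is_posterior_mean S K m0 y m ->
    is_gaussian_measure (Post y) m (posterior_cov S K).

End inverse_problem.

Section map_test.
Variables (R : realType) (X Y : hilbertSpace R) (phi : X).

Definition X_H : set X := [set x | inner phi x <= 0].
Definition X_K : set X := [set x | 0 < inner phi x].

Definition map_test (Post : (Y -> R) -> probability (borel X) R)
    (y : Y -> R) : nat :=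
  if (Post y X_H < Post y X_K)%E then 1%N else 0%N.

End map_test.

(* Main.v *)
Require Import Defs.
From HB Require Import structures.
From mathcomp Require Import all_boot all_order all_algebra.
From mathcomp Require Import all_classical all_reals all_analysis.
From mathcomp Require Import measurable_realfun ring lra.

Set Implicit Arguments.
Unset Strict Implicit.
Unset Printing Implicit Defensive.

Import Order.TTheory GRing.Theory Num.Theory.
Import numFieldNormedType.Exports.

Local Open Scope classical_set_scope.
Local Open Scope ring_scope.

(** Write S = C0^{1/2} and A = T^* T.  Under the posterior, <phi, .> is normal
    with positive variance and mean <phi, m0> + <u - m0, a> + sigma Z(T S k),
    where k = K S phi and a = A S k.  The test therefore rejects as soon as this
    mean is positive.  If a is not a multiple of phi, then <u, a> can be made
    arbitrarily large with <phi, u> = 0, whereas the noise term does not depend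
    on u, so the probability of rejection tends to 1.  If a = c phi, then, since
    S commutes with A and hence with K, phi is an eigenvector of S A S.

    That S commutes with A as soon as S^2 does needs no spectral theorem:
    D = A S - S A satisfies S D = - D S, hence (1 + S)^n D = D (1 - S)^n.  When
    0 <= S <= 1, the left factor does not decrease norms, while (1 - S)^n S
    tends strongly to 0; hence D S = 0, so S D = 0, and D = 0 because S is
    injective. *)

(** * Bilinearity and Cauchy-Schwarz inequalities in a real Hilbert space *)

Section inner_product.
Variables (R : realType) (X : hilbertSpace R).
Implicit Types x y z : X.

Lemma innerDr x y z : inner x (y + z) = inner x y + inner x z.
Proof. by rewrite innerC innerDl !(innerC _ x). Qed.

Lemma innerZr a x y : inner x (a *: y) = a * inner x y.
Proof. by rewrite innerC innerZl innerC. Qed.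

Lemma innerNl x y : inner (- x) y = - inner x y.
Proof. by rewrite -scaleN1r innerZl mulN1r. Qed.

Lemma innerNr x y : inner x (- y) = - inner x y.
Proof. by rewrite innerC innerNl innerC. Qed.

Lemma innerBl x y z : inner (x - y) z = inner x z - inner y z.
Proof. by rewrite innerDl innerNl. Qed.

Lemma innerBr x y z : inner x (y - z) = inner x y - inner x z.
Proof. by rewrite innerDr innerNr. Qed.

Lemma inner_eq0 x : (inner x x == 0) = (x == 0).
Proof. by rewrite inner_norm sqrf_eq0 normr_eq0. Qed.

Lemma inner_ge0 x : 0 <= inner x x.
Proof. by rewrite inner_norm sqr_ge0. Qed.

Lemma inner_gt0 x : (0 < inner x x) = (x != 0).
Proof. by rewrite lt0r inner_eq0 inner_ge0 andbT. Qed.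

Lemma inner_inj x y : (forall z, inner x z = inner y z) -> x = y.
Proof.
by move=> e; apply/eqP; rewrite -subr_eq0 -inner_eq0 innerBl e subrr.
Qed.

(** The quadratic [t |-> <A (t x + y), t x + y>] is nonnegative, so its discriminant is not
    positive. *)
Lemma psd_CauchySchwarz (A : X -> X) x y : linear A -> self_adjoint A ->
  positive_semidefinite A ->
  inner (A x) y ^+ 2 <= inner (A x) x * inner (A y) y.
Proof.
move=> Al As Ap.
have q t : 0 <= t ^+ 2 * inner (A x) x + 2 * t * inner (A x) y + inner (A y) y.
  have := Ap (t *: x + y); rewrite Al !innerDl !innerDr !innerZl !innerZr.
  by rewrite (As y x) (innerC y (A x)); congr (0 <= _); ring.
set a := inner (A x) x in q *; set b := inner (A x) y in q *.
set c := inner (A y) y in q *.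
have a0 : 0 <= a by exact: Ap.
have [a1|/negP a1] := boolP (a == 0); last first.
  have {a1}a1 : 0 < a by rewrite lt0r a0 andbT; apply/negP.
  have := q (- b / a); rewrite -(pmulr_rge0 _ a1).
  have -> : a * ((- b / a) ^+ 2 * a + 2 * (- b / a) * b + c) = a * c - b ^+ 2.
    by field; rewrite gt_eqF.
  by rewrite subr_ge0.
rewrite (eqP a1) mul0r in q *.
have [->|b0] := eqVneq b 0; first by rewrite expr0n.
(* With [a = 0] the polynomial is affine of slope [2 b]; at this [t] it would equal -1. *)
have := q (- (c + 1) / (2 * b)); rewrite mulr0 add0r.
have -> : 2 * (- (c + 1) / (2 * b)) * b + c = -1 by field.
by rewrite oppr_ge0 ler10.
Qed.

Lemma CauchySchwarz x y : `|inner x y| <= `|x| * `|y|.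
Proof.
rewrite -ler_sqr ?nnegrE ?mulr_ge0// exprMn real_normK ?num_real//.
rewrite -!inner_norm; apply: (@psd_CauchySchwarz idfun) => //.
by move=> z; exact: inner_ge0.
Qed.

End inner_product.

(** * Bounded linear maps and adjoints *)

Section operator_theory.
Variables (R : realType) (X Y : hilbertSpace R).

Lemma linear_sub (V W : lmodType R) (f : V -> W) : linear f ->
  {morph f : x y / x - y}.
Proof. by move=> fl x y; rewrite -scaleN1r addrC fl scaleN1r addrC. Qed.

Lemma linear_scale (V W : lmodType R) (f : V -> W) : linear f ->
  forall a, {morph f : x / a *: x}.
Proof.
move=> fl a x; have f0 : f 0 = 0 by rewrite -(subrr 0) linear_sub// subrr.
by rewrite -[a *: x]addr0 fl f0 addr0.
Qed.

Lemma linear_add (V W : lmodType R) (f : V -> W) : linear f ->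
  {morph f : x y / x + y}.
Proof. by move=> fl x y; rewrite -[x]scale1r fl !scale1r. Qed.

Lemma adjoint_linear (T : X -> Y) (T' : Y -> X) : is_adjoint T T' -> linear T'.
Proof.
move=> TT' a y z; apply: inner_inj => x.
by rewrite innerC -TT' innerDr innerZr !TT' innerDl innerZl !(innerC x).
Qed.

Lemma linear_continuous_bounded (V W : normedModType R) (f : V -> W) :
  linear f -> continuous f ->
  exists2 M, 0 < M & forall x, `|f x| <= M * `|x|.
Proof.
move=> fl fc.
pose g : {linear V -> W} := HB.pack f (GRing.isLinear.Build _ _ _ _ f fl).
have gc : continuous g := fc.
by have /linear_bounded_continuous/linear_boundedP/pinfty_ex_gt0 := gc.
Qed.

(** Divide [|T' y|^2 = <T (T' y), y> <= M |T' y| |y|] by [|T' y|]. *)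
Lemma adjoint_bounded (T : X -> Y) (T' : Y -> X) M : 0 <= M ->
  (forall x, `|T x| <= M * `|x|) -> is_adjoint T T' ->
  forall y, `|T' y| <= M * `|y|.
Proof.
move=> M0 TM TT' y; have [->|Ty0] := eqVneq (T' y) 0.
  by rewrite normr0 mulr_ge0.
rewrite -(@ler_pM2l _ `|T' y|) ?normr_gt0//.
rewrite -expr2 -inner_norm -TT'.
apply: (le_trans (ler_norm _)); apply: (le_trans (CauchySchwarz _ _)).
by rewrite mulrCA mulrA ler_wpM2r.
Qed.

End operator_theory.

(** * Commutation with a positive square root *)

Section commutation.
Variables (R : realType) (X : hilbertSpace R).

(** Quantitative form of the strong convergence of [S (1 - S)^n] to 0, with rate [1 / sqrt n]. *)
Lemma norm_iter_subid (S : X -> X) x n : linear S -> self_adjoint S ->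
  positive_semidefinite S -> (forall z, `|S z| <= `|z|) ->
  n%:R * `|S (iter n (fun z => z - S z) x)| ^+ 2 <= `|x| ^+ 2.
Proof.
move=> Sl Ss Sp S1.
have Slin := linear_sub Sl.
(* Cauchy-Schwarz for the form of [S] at [z] and [S z] gives [|S z|^4 <= <S z, z> <S (S z), S z>],
   whose last factor is at most [|S z|^2]. *)
have S2 z : `|S z| ^+ 2 <= inner (S z) z.
  have [Sz0|Sz0] := eqVneq (S z) 0.
    by rewrite {1}Sz0 normr0 expr0n; exact: Sp.
  rewrite -(@ler_pM2r _ (`|S z| ^+ 2)) ?exprn_gt0 ?normr_gt0//.
  rewrite -expr2 -{1}inner_norm.
  apply: (le_trans (psd_CauchySchwarz z (S z) Sl Ss Sp)).
  apply: ler_wpM2l; first exact: Sp.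
  apply: (le_trans (ler_norm _)); apply: (le_trans (CauchySchwarz _ _)).
  by rewrite expr2 ler_wpM2r.
have dec z : `|z - S z| ^+ 2 <= `|z| ^+ 2 - `|S z| ^+ 2.
  rewrite -!inner_norm innerBl !innerBr (innerC z (S z)).
  by have := S2 z; rewrite -inner_norm; lra.
(* Sum [dec] along the orbit of x, on which |S z| decreases. *)
suff: `|iter n (fun z => z - S z) x| ^+ 2 +
      n%:R * `|S (iter n (fun z => z - S z) x)| ^+ 2 <= `|x| ^+ 2.
  by apply: le_trans; rewrite lerDr sqr_ge0.
elim: n => [|n IH]; first by rewrite mul0r addr0.
apply: le_trans IH; rewrite iterS; set z := iter n _ x.
have := dec z.
have : `|S (z - S z)| ^+ 2 <= `|S z| ^+ 2.
  rewrite Slin; apply: (le_trans (dec _)).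
  by rewrite gerBl sqr_ge0.
move=> h1 h2; rewrite -natr1.
have : n%:R * `|S (z - S z)| ^+ 2 <= n%:R * `|S z| ^+ 2 by rewrite ler_wpM2l.
by move: h1 h2; lra.
Qed.

Lemma anticommute_psd_eq0 (S D : X -> X) M : linear S -> self_adjoint S ->
  positive_semidefinite S -> (forall z, `|S z| <= `|z|) ->
  linear D -> (forall z, `|D z| <= M * `|z|) ->
  (forall z, S (D z) = - D (S z)) -> forall x, D (S x) = 0.
Proof.
move=> Sl Ss Sp S1 Dl DM SD x.
pose E := fun z => z - S z.
have Slin := linear_sub Sl.
have Dlin := linear_sub Dl.
have ge z : `|z| <= `|z + S z|.
  rewrite -ler_sqr ?nnegrE// -!inner_norm innerDl !innerDr (innerC z (S z)).
  by have := Sp z; have := inner_ge0 (S z); lra.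
have DE n z : `|D z| <= `|D (iter n E z)|.
  elim: n => // n IH; apply: (le_trans IH); rewrite iterS.
  have -> t : D (E t) = D t + S (D t) by rewrite /E Dlin SD.
  exact: ge.
have ES n z : iter n E (S z) = S (iter n E z).
  by elim: n => // n IH; rewrite !iterS IH /E Slin.
have b n : n%:R * `|D (S x)| ^+ 2 <= (M * `|x|) ^+ 2.
  apply: (@le_trans _ _ (n%:R * (M * `|S (iter n E x)|) ^+ 2)).
    rewrite ler_wpM2l// ler_sqr ?nnegrE//; last exact: le_trans (DM _).
    by rewrite -ES; apply: (le_trans (DE n _)); exact: DM.
  rewrite !exprMn mulrCA ler_wpM2l ?sqr_ge0//.
  exact: norm_iter_subid.
apply/eqP; rewrite -normr_eq0 -sqrf_eq0; apply/negPn/negP => D0.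
have D1 : 0 < `|D (S x)| ^+ 2 by rewrite lt0r D0 sqr_ge0.
(* An integer [n] beyond this ratio contradicts [b]. *)
have := b (Num.bound ((M * `|x|) ^+ 2 / `|D (S x)| ^+ 2)).
apply/negP; rewrite -ltNge -ltr_pdivrMr//.
by apply: archi_boundP; rewrite divr_ge0// sqr_ge0.
Qed.

Lemma commute_sqrt (S A : X -> X) : linear S -> continuous S ->
  self_adjoint S -> positive_semidefinite S -> (forall x, S x = 0 -> x = 0) ->
  linear A -> continuous A ->
  (forall x, A (S (S x)) = S (S (A x))) ->
  forall x, A (S x) = S (A x).
Proof.
move=> Sl Sc Ss Sp Si Al Ac ASS x.
have [M M0 SM] := linear_continuous_bounded Sl Sc.
have [N N0 AN] := linear_continuous_bounded Al Ac.
(* Rescaling makes [|L z| <= |z|]; [D] is still built from [S] and anticommutes with [L] as well. *)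
pose L := fun z => M^-1 *: S z.
pose D := fun z => A (S z) - S (A z).
have DZ a z : D (a *: z) = a *: D z.
  by rewrite /D !(linear_scale Sl, linear_scale Al) scalerBr.
have SD z : S (D z) = - D (S z).
  by rewrite /D (linear_sub Sl) ASS opprB.
suff DS z : D (S z) = 0.
  apply/eqP; rewrite -subr_eq0; apply/eqP; apply: Si.
  by rewrite -/(D x) SD DS oppr0.
have M1 : M^-1 != 0 by rewrite invr_neq0// gt_eqF.
suff : D (L z) = 0.
  by rewrite /L DZ => /eqP; rewrite scaler_eq0 (negbTE M1) => /eqP.
apply: (@anticommute_psd_eq0 L D (N * M + M * N)).
- by move=> a y t; rewrite /L Sl scalerDr !scalerA (mulrC M^-1).
- by move=> y t; rewrite /L innerZl innerZr Ss.
- by move=> y; rewrite /L innerZl mulr_ge0// invr_ge0 ltW.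
- by move=> y; rewrite /L normrZ gtr0_norm ?invr_gt0// ler_pdivrMl.
- move=> a y t; rewrite /D !(Sl, Al) scalerBr.
  by rewrite opprD addrACA.
- move=> y; apply: (le_trans (ler_normB _ _)); rewrite mulrDl lerD//.
    by apply: (le_trans (AN _)); rewrite -mulrA ler_pM2l.
  by apply: (le_trans (SM _)); rewrite -mulrA ler_pM2l.
- by move=> y; rewrite /L DZ SD scalerN.
Qed.

End commutation.

(** * Half-line probabilities of a normal law with positive mean *)

Lemma normal_pdf_lt_opp (R : realType) (m s x : R) : 0 < m -> s != 0 -> 0 < x ->
  normal_pdf m s (- x) < normal_pdf m s x.
Proof.
move=> m0 s0 x0; rewrite !normal_pdfE//= ltr_pM2l ?normal_peak_gt0//.
rewrite ltr_expR ltr_pM2r; last first.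
  by rewrite invr_gt0 pmulrn_lgt0// exprn_even_gt0.
by rewrite ltrN2 -subr_gt0 (_ : _ - _ = 4 * (x * m)) ?mulr_gt0//; ring.
Qed.

(** Reflecting the left half-line, the difference of the two sides is the integral of [h > 0] over
    []0, +oo[]. If it vanished, this half-line would be a null set. *)
Lemma normal_prob_lt (R : realType) (m s : R) : 0 < m -> s != 0 ->
  (normal_prob m s `]-oo, 0%R] < normal_prob m s `]0%R, +oo[)%E.
Proof.
move=> m0 s0.
have mf : measurable_fun [set: R] (normal_pdf m s).
  exact: measurable_normal_pdf.
have mfN : measurable_fun [set: R] (fun x : R => normal_pdf m s (- x)).
  exact: (measurableT_comp mf).
have left : normal_prob m s `]-oo, 0%R] =
    (\int[lebesgue_measure]_(x in `]0%R, +oo[) (normal_pdf m s (- x))%:E)%E.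
  (* Reflection pairs []-oo, 0]] with the half-line closed at 0; adding that endpoint does not
     change the integral. *)
  rewrite integral_itv_obnd_cbnd; last first.
    by apply/measurable_EFinP; exact: measurable_funTS.
  rewrite ge0_integration_by_substitution0; last 2 first.
  - exact/measurable_EFinP.
  - by move=> r; rewrite lee_fin normal_pdf_ge0.
  by apply: eq_integral => x _; rewrite opprK.
pose h (x : R) := normal_pdf m s x - normal_pdf m s (- x).
have h0 x : x \in `]0%R, +oo[%classic -> 0 < h x.
  rewrite inE/= in_itv/= andbT => x0; rewrite subr_gt0.
  exact: normal_pdf_lt_opp.
have mh : measurable_fun [set: R] h by exact: measurable_funB.
have -> : normal_prob m s `]0%R, +oo[ =
    (\int[lebesgue_measure]_(x in `]0%R, +oo[)
      ((h x)%:E + (normal_pdf m s (- x))%:E))%E.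
  by apply: eq_integral => x _; rewrite -EFinD subrK.
rewrite ge0_integralD//=; last 4 first.
- by move=> x x0; rewrite lee_fin ltW// h0// inE.
- by apply/measurable_EFinP; exact: measurable_funTS.
- by move=> x _; rewrite lee_fin normal_pdf_ge0.
- by apply/measurable_EFinP; exact: measurable_funTS.
(* The reflected term is a finite probability, so it can be cancelled. *)
rewrite left lteDr; last first.
  by rewrite -left; exact: fin_num_measure.
rewrite lt0e integral_ge0 ?andbT; last first.
  by move=> x x0; rewrite lee_fin ltW// h0// inE.
apply/eqP => h_eq0.
have /ae_eq_integral_abs :
    (\int[lebesgue_measure]_(x in `]0%R, +oo[) `|(h x)%:E| = 0)%E.
  rewrite -h_eq0; apply: eq_integral => x x0.
  by rewrite gee0_abs// lee_fin ltW// h0.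
move=> /(_ (measurable_itv _)) [].
  by apply/measurable_EFinP; exact: measurable_funTS.
move=> N [mN N0 hN].
have : (lebesgue_measure `]0%R, +oo[%classic <= lebesgue_measure N)%E.
  apply: le_measure; rewrite ?inE// => x x0; apply: hN => /= /(_ x0) [] hx.
  by have := h0 x; rewrite inE hx ltxx => /(_ x0).
by rewrite N0 lebesgue_measure_itv/= ltry.
Qed.

(** Both half-spaces are preimages of half-lines under [inner phi], and the positive variance
    excludes the Dirac branch of [normal_law]. *)
Lemma gaussian_halfspace_lt (R : realType) (X : hilbertSpace R) (phi m : X)
    (C : X -> X) (mu : probability (borel X) R) :
  is_gaussian_measure mu m C -> 0 < inner (C phi) phi -> 0 < inner phi m ->
  (mu (X_H phi) < mu (X_K phi))%E.
Proof.
move=> muG C0 m0.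
have -> : X_H phi = inner phi @^-1` `]-oo, 0%R].
  by apply/seteqP; split=> x /=; rewrite in_itv.
have -> : X_K phi = inner phi @^-1` `]0%R, +oo[.
  by apply/seteqP; split=> x /=; rewrite in_itv/= andbT.
rewrite !muG//; rewrite /normal_law gt_eqF//.
by apply: normal_prob_lt => //; rewrite gt_eqF// sqrtr_gt0.
Qed.

(** * Outer probability and tails of a real random variable *)

Section probability_facts.
Context d (Omega : measurableType d) (R : realType).
Variable P : probability Omega R.

Lemma outer_prob_le1 (B : set Omega) : ((P^*)%mu B <= 1)%E.
Proof.
rewrite -(@probability_setT _ _ _ P) -measurable_mu_extE//.
exact: le_outer_measure.
Qed.

(** Serves for rejection events [B], whose measurability is not known: [A] lies in [B] up to a null
    set, and the outer measure is subadditive. *)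
Lemma prob_le_outer_ae (A B : set Omega) : measurable A ->
  {ae P, forall w, A w -> B w} -> (P A <= (P^*)%mu B)%E.
Proof.
move=> mA [N [mN N0 ABN]].
rewrite -measurable_mu_extE// -[leRHS]adde0 -N0 -measurable_mu_extE//.
apply: le_trans (outer_measureU2 _ _ _); apply: le_outer_measure => w Aw.
have [Bw|nBw] := pselect (B w); first by left.
by right; apply: ABN => /= /(_ Aw).
Qed.

Lemma measurable_RV_gt (f : {RV P >-> R}) (a : R) :
  measurable [set w | a < f w].
Proof.
rewrite [X in measurable X](_ : _ = f @^-1` `]a, +oo[); last first.
  by apply/seteqP; split=> w /=; rewrite in_itv/= andbT.
by rewrite -[X in measurable X]setTI; exact: measurable_funP.
Qed.

(** Continuity from below: as [f] is real-valued, the events increase to the whole space. *)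
Lemma prob_gt_opp_cvg (f : {RV P >-> R}) :
  P [set w | - n%:R < f w] @[n --> \oo] --> 1%E.
Proof.
have FT : \bigcup_n [set w | - n%:R < f w] = setT.
  apply/seteqP; split=> // w _; exists (Num.bound `|f w|) => //=.
  rewrite ltrNl; apply: le_lt_trans (archi_boundP _) => //.
  by rewrite -normrN ler_norm.
rewrite -(@probability_setT _ _ _ P) -FT.
apply: nondecreasing_cvg_mu; last 1 first.
- move=> i j ij; apply/subsetPset => w /=; apply: le_lt_trans.
  by rewrite lerN2 ler_nat.
- by move=> n; exact: measurable_RV_gt.
- by rewrite FT.
Qed.

End probability_facts.

(** The component [v] of [a] orthogonal to [phi] is nonzero and [<v, a> = |v|^2], so a multiple of
    [v] works; it lies on the boundary hyperplane of [X_H]. *)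
Lemma ex_halfspace_inner_eq (R : realType) (X : hilbertSpace R) (phi a : X)
    (t : R) :
  phi != 0 -> (forall c : R, a != c *: phi) ->
  exists2 u, X_H phi u & inner u a = t.
Proof.
move=> phi0 aphi; pose c := inner a phi / inner phi phi.
pose v := a - c *: phi.
have vphi : inner phi v = 0.
  by rewrite /v innerBr innerZr /c divfK ?inner_eq0// innerC subrr.
have va : inner v a != 0.
  have -> : inner v a = inner v v.
    have aE : a = v + c *: phi by rewrite subrK.
    by rewrite aE innerDr innerZr (innerC v phi) vphi mulr0 addr0.
  by rewrite inner_eq0 subr_eq0.
exists ((t / inner v a) *: v); first by rewrite /X_H /= innerZr vphi mulr0.
by rewrite innerZl divfK.
Qed.

(** * The regularized normal operator [M] and its inverse [K] *)

Section normal_operator.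
Variables (R : realType) (X Y : hilbertSpace R) (T : {linear X -> Y}).
Variables (Tadj : Y -> X) (sigma : R) (S K : X -> X).
Hypotheses (TadjP : is_adjoint T Tadj) (sigma_gt0 : 0 < sigma).
Hypotheses (Sl : linear S) (Ss : self_adjoint S).

Let M x := S (Tadj (T (S x))) + sigma ^+ 2 *: x.
Hypothesis KP : is_inverse M K.

Let Tadjl := adjoint_linear TadjP.
Let MK : cancel K M. Proof. exact: KP.2. Qed.
Let KM : cancel M K. Proof. exact: KP.1. Qed.

Let inner_M x y : inner (M x) y = inner (T (S x)) (T (S y)) +
  sigma ^+ 2 * inner x y.
Proof. by rewrite /M innerDl innerZl Ss innerC -TadjP innerC. Qed.

Lemma resolvent_self_adjoint : self_adjoint K.
Proof.
move=> x y; have : inner (M (K x)) (K y) = inner (K x) (M (K y)).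
  rewrite inner_M [RHS]innerC inner_M (innerC (K y)).
  by rewrite (innerC (T (S (K y)))).
by rewrite !MK.
Qed.

Let Ml : linear M.
Proof.
move=> a x y; rewrite /M Sl linearP Tadjl Sl scalerDr.
by rewrite !scalerA (mulrC _ a) -scalerA addrACA -scalerDr.
Qed.

(** [<K x, x> = <M (K x), K x> = |T S K x|^2 + sigma^2 |K x|^2], and [K x] is nonzero because
    [M 0 = 0]. *)
Lemma resolvent_pd : positive_definite K.
Proof.
move=> x x0; rewrite -{2}(MK x) innerC inner_M ltr_wpDl ?inner_ge0//.
rewrite mulr_gt0 ?exprn_gt0// inner_gt0; apply: contra x0 => /eqP Kx0.
by have := linear_scale Ml 0 0; rewrite !scale0r -(MK x) Kx0 => ->.
Qed.

(** Since [K] commutes with [S], the left side of the eigenvalue-like hypothesis is [(M - sigma^2) K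
    phi = phi - sigma^2 K phi]. So [phi] is an eigenvector of [K], then of [M], then of
    [M - sigma^2]. *)
Lemma resolvent_eigenvector phi c :
  (forall x, Tadj (T (S x)) = S (Tadj (T x))) -> phi != 0 ->
  Tadj (T (S (K (S phi)))) = c *: phi ->
  is_eigenvector (fun x => S (Tadj (T (S x)))) phi.
Proof.
move=> AS phi0.
have KS x : K (S x) = S (K x).
  have SM y : S (M y) = M (S y).
    by rewrite /M (linear_add Sl) (linear_scale Sl) (AS (S y)).
  by rewrite -{1}(MK x) SM KM.
rewrite KS AS => ASK.
have s0 : sigma ^+ 2 != 0 by rewrite expf_neq0// gt_eqF.
have KE : K phi = ((1 - c) / sigma ^+ 2) *: phi.
  apply: (scalerI s0); rewrite scalerA mulrC divfK// scalerBl scale1r -ASK.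
  by apply/esym/eqP; rewrite subr_eq addrC; apply/eqP/esym; exact: MK.
set a := (1 - c) / _ in KE.
have phiE : phi = a *: M phi by rewrite -(linear_scale Ml) -KE MK.
have a0 : a != 0.
  by apply: contra phi0 => /eqP a0; rewrite phiE a0 scale0r.
split=> //; exists (a^-1 - sigma ^+ 2).
by rewrite scalerBl {2}phiE scalerA mulVf// scale1r addrK.
Qed.

End normal_operator.

(** * Rejection probabilities on the boundary of the null hypothesis *)

Theorem theorem2p6 (R : realType) (X Y : hilbertSpace R)
  (sepX : separable X) (sepY : separable Y)
  (phi : X) (phi_neq0 : phi != 0)
  (T : {linear X -> Y}) (T_bounded : continuous T)
  (Tadj : Y -> X) (TadjP : is_adjoint T Tadj)
  (sigma : R) (sigma_gt0 : 0 < sigma)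
  (m0 : X)
  (C0 : {linear X -> X}) (C0_bounded : continuous C0)
  (C0_sa : self_adjoint C0) (C0_pd : positive_definite C0)
  (C0_tr : trace_class C0)
  (* C0h is C_0^{1/2} *)
  (C0h : X -> X) (C0hP : is_sqrt C0 C0h)
  (* K is (C_0^{1/2} T^* T C_0^{1/2} + sigma^2 Id)^{-1} *)
  (K : X -> X)
  (KP : is_inverse
          (fun x => C0h (Tadj (T (C0h x))) + sigma ^+ 2 *: x) K)
  (d : measure_display) (Omega : measurableType d) (P : probability Omega R)
  (Z : Y -> {RV P >-> R}) (Z_white : white_noise Z)
  (* C_0^{1/2} T^* Z exists in X almost surely *)
  (Z_riesz : {ae P, forall w, exists r : X,
                riesz_representer (fun x => Z (T (C0h x)) w) r})
  (Post : (Y -> R) -> probability (borel X) R)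
  (PostP : is_posterior T sigma C0h K m0 Post)
  (comm : forall x, C0 (Tadj (T x)) = Tadj (T (C0 x)))
  (phi_not_eigen :
     ~ is_eigenvector (fun x => C0h (Tadj (T (C0h x)))) phi) :
  ereal_sup [set data_law T sigma Z u [set y | map_test phi Post y = 1%N]
            | u in X_H phi] = 1%E.
Proof.
have [S2l S2c S2s S2p S2C] := C0hP.
have Tadjl := adjoint_linear TadjP.
have S_inj x : C0h x = 0 -> x = 0.
  move=> Sx0; apply/eqP/negPn/negP => /C0_pd.
  by rewrite -S2C S2s Sx0 -(scale0r (0 : X)) innerZl mul0r ltxx.
have comm_sqrt x : Tadj (T (C0h x)) = C0h (Tadj (T x)).
  have Al : linear (Tadj \o T) by move=> a y z /=; rewrite linearP Tadjl.
  have Ac : continuous (Tadj \o T).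
    have [M M0 TM] := linear_continuous_bounded (linearP T) T_bounded.
    pose A : {linear X -> X}
      := HB.pack (Tadj \o T) (GRing.isLinear.Build _ _ _ _ (Tadj \o T) Al).
    apply/(@linear_bounded_continuous _ _ _ A)/linear_boundedP.
    near=> r => y; apply: (@le_trans _ _ (M * M * `|y|)).
      apply: (le_trans (adjoint_bounded (ltW M0) TM TadjP _)).
      by rewrite -mulrA ler_pM2l.
    by apply: ler_wpM2r => //; near: r; apply: nbhs_pinfty_ge; rewrite num_real.
  apply: (commute_sqrt S2l S2c S2s S2p S_inj Al Ac) => y /=.
  by rewrite !S2C comm.
pose k := K (C0h phi); pose a := Tadj (T (C0h k)).
have a_phi c : a != c *: phi.
  apply: contra_not_neq phi_not_eigen => ac.
  exact: (resolvent_eigenvector TadjP sigma_gt0 S2l KP comm_sqrt phi_neq0 ac).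
(* The variance is [sigma^2 <K S phi, S phi>], with [S phi] nonzero by injectivity. *)
have C_phi : 0 < inner (posterior_cov sigma C0h K phi) phi.
  rewrite /posterior_cov innerZl mulr_gt0 ?exprn_gt0// S2s.
  apply: (resolvent_pd TadjP sigma_gt0 S2l S2s KP).
  by apply: contra phi_neq0 => /eqP/S_inj ->.
have K_sa := resolvent_self_adjoint TadjP S2s KP.
have mapE u w r : riesz_representer (fun x => Z (T (C0h x)) w) r ->
    0 < inner phi m0 + inner (u - m0) a + sigma * Z (T (C0h k)) w ->
    map_test phi Post (data T sigma Z u w) = 1%N.
  move=> rP pos; pose r' := C0h (Tadj (T (u - m0))) + sigma *: r.
  have r'P : riesz_representer (fun x => data T sigma Z u w (T (C0h x)) -
      inner (T m0) (T (C0h x))) r'.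
    move=> x; rewrite /data /r' rP innerDl innerZl S2s (innerC (Tadj _)) -TadjP.
    by rewrite (innerC _ (T (u - m0))) linearB innerBl addrAC.
  have PostG := PostP _ _ (ex_intro _ r' (conj r'P erefl)).
  rewrite /map_test (gaussian_halfspace_lt PostG)//.
  (* Moving [S] and [K] onto [phi] gives [<phi, S K r'> = <k, r'>], which is the centered data
     evaluated at [T S k]. *)
  suff -> : inner phi (m0 + C0h (K r')) =
    inner phi m0 + inner (u - m0) a + sigma * Z (T (C0h k)) w by [].
  rewrite innerDr -S2s -K_sa (innerC _ r') -r'P /data /a -TadjP linearB innerBl.
  by rewrite addrAC addrA.
apply/eqP; rewrite eq_le; apply/andP; split.
  by apply: ge_ereal_sup => _ [u _ <-]; exact: outer_prob_le1.
have := @prob_gt_opp_cvg _ _ _ P (Z (T (C0h k))).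
apply: cvge_le; apply: nearW => n.
(* This value of [<u, a>] makes the posterior mean of [<phi, .>] equal to [sigma (n + Z (T S k))],
   positive exactly when the noise exceeds [-n]. *)
have [u uH ua] := ex_halfspace_inner_eq
  (sigma * n%:R - inner phi m0 + inner m0 a) phi_neq0 a_phi.
apply: le_trans (ereal_sup_ubound _); last by exists u.
apply: prob_le_outer_ae; first exact: measurable_RV_gt.
apply: filterS Z_riesz => w [r rP] /= Zn; apply: (mapE _ _ r rP).
rewrite innerBl ua addrK addrCA subrr addr0 -mulrDr mulr_gt0//.
by rewrite -ltrBlDl sub0r.
Unshelve. all: by end_near. Qed.
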